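(* Let $\sigma,\rho\subseteq\mathbb{N}$ be fixed finite sets with $0\notin\rho$. The $[\sigma,\rho]$ Dominating Set problem on connected graphs, parameterized by the neighborhood diversity $b$ of the input graph, admits a linear kernel (with at most $(\max(\max\sigma,\max\rho)+1)\, b$ vertices).
   Context: $\mathbb{N}=\{0,1,2,\dots\}$. For $\sigma,\rho\subseteq\mathbb{N}$, a set $D\subseteq V(G)$ is a $[\sigma,\rho]$-dominating set if every $v\in D$ has $|N(v)\cap D|\in\sigma$ and every $v\in V(G)\setminus D$ has $|N(v)\cap D|\in\rho$ ($N(v)$ the open neighborhood). The $[\sigma,\rho]$ Dominating Set problem: given a graph $G$ and integer $K$, decide whether $G$ has a $[\sigma,\rho]$-dominating set of size at most $K$. Two vertices $u,v$ have the same type if $N(v)\setminus\{u\}=N(u)\setminus\{v\}$; $G$ has neighborhood diversity $b$ if $V(G)$ can be partitioned into at most $b$ classes such that all vertices in each class have the same type. A linear kernel is a polynomial-time algorithm mapping an instance with parameter $b$ to an equivalent instance of the same problem of size $O(b)$. *)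

(* Defs.v *)
From HB Require Import structures.
From mathcomp Require Import all_boot all_order all_algebra.
From mathcomp Require Import finmap.
Set Implicit Arguments. Unset Strict Implicit. Unset Printing Implicit Defensive.
Import Order.TTheory GRing.Theory Num.Theory.

Record sgraph := SGraph {
  nverts : nat;
  adj : rel 'I_nverts;
  adj_sym : symmetric adj;
  adj_irr : irreflexive adj }.

Definition vertex (G : sgraph) : finType := 'I_(nverts G).

Definition nbr (G : sgraph) (v : vertex G) : {set vertex G} :=
  [set w | adj v w].

(* The graph without vertices does not count as connected. *)
Definition connected (G : sgraph) : Prop :=
  0 < nverts G /\ forall u v : vertex G, connect (@adj G) u v.

Definition same_type (G : sgraph) (u v : vertex G) : Prop :=
  nbr v :\ u = nbr u :\ v.

Definition has_nbr_diversity (G : sgraph) (b : nat) : Prop :=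
  exists P : {set {set vertex G}},
    [/\ partition P [set: vertex G], #|P| <= b &
        forall C, C \in P -> {in C &, forall u v, same_type u v}].

Definition dominating (sigma rho : {pred nat}) (G : sgraph)
    (D : {set vertex G}) : Prop :=
  (forall v, v \in D -> #|nbr v :&: D| \in sigma) /\
  (forall v, v \notin D -> #|nbr v :&: D| \in rho).

Record instance := Instance { igraph : sgraph; ibound : int }.

Definition yes_instance (sigma rho : {pred nat}) (I : instance) : Prop :=
  exists D : {set vertex (igraph I)},
    dominating sigma rho D /\ (Posz #|D| <= ibound I)%R.

Definition bitlen (z : int) : nat := (trunc_log 2 `|z|).+1.

(* Size of an instance as it is measured for a linear kernel: the number of
   vertices, plus the bits of the integer bound. *)
Definition isize (I : instance) : nat :=
  nverts (igraph I) + bitlen (ibound I).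

(* An instance is given to an algorithm as the number of vertices, the integer
   bound and the adjacency matrix, row by row. *)
Definition encode (I : instance) : seq int :=
  [:: Posz (nverts (igraph I)), ibound I &
      [seq Posz (adj u v) | u <- enum (vertex (igraph I)),
                                v <- enum (vertex (igraph I))]].

(* Algorithms are programs of the random access machine of Cook and Reckhow:
   registers X_0, X_1, ... holding integers, a read-only input tape and a
   write-only output tape of integers. Every step costs one unit of time; as
   addition and subtraction are the only arithmetic operations, a running time
   polynomial in the number of bits of the input defines the same polynomial
   time as Turing machines do. *)
Inductive instr :=
| Const (i : nat) (c : int)    (* X_i <- c *)
| Add (i j k : nat)            (* X_i <- X_j + X_k *)
| Sub (i j k : nat)            (* X_i <- X_j - X_k *)
| Peek (i j : nat)             (* X_i <- X_{X_j} *)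
| Poke (i j : nat)            (* X_{X_i} <- X_j *)
| JumpPos (i l : nat)          (* if 0 < X_i then go to instruction l *)
| Read (i : nat)               (* X_i <- next input *)
| Write (i : nat).             (* append X_i to the output *)

Definition program := seq instr.

Record state := State {
  pc : nat;
  reg : nat -> int;
  input : seq int;
  output : seq int }.

Definition set_reg (s : state) (i : nat) (z : int) : state :=
  State (pc s).+1 [eta reg s with i |-> z] (input s) (output s).

(* There is no next state when the program counter is outside the program, when
   a negative number is used as an address, or when reading past the end of the
   input. Only the first case is a normal termination, see [halts]. *)
Definition step (P : program) (s : state) : option state :=
  match onth P (pc s) with
  | None => None
  | Some (Const i c) => Some (set_reg s i c)
  | Some (Add i j k) => Some (set_reg s i (reg s j + reg s k)%R)
  | Some (Sub i j k) => Some (set_reg s i (reg s j - reg s k)%R)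
  | Some (Peek i j) =>
      if reg s j is Posz a then Some (set_reg s i (reg s a)) else None
  | Some (Poke i j) =>
      if reg s i is Posz a then Some (set_reg s a (reg s j)) else None
  | Some (JumpPos i l) =>
      Some (State (if (0 < reg s i)%R then l else (pc s).+1)
                  (reg s) (input s) (output s))
  | Some (Read i) =>
      if input s is z :: w
      then Some (State (pc s).+1 [eta reg s with i |-> z] w (output s))
      else None
  | Some (Write i) =>
      Some (State (pc s).+1 (reg s) (input s) (rcons (output s) (reg s i)))
  end.

Fixpoint steps (P : program) (t : nat) (s : state) : option state :=
  if t is t'.+1 then obind (steps P t') (step P s) else Some s.

Definition halts (P : program) (w : seq int) (t : nat) (w' : seq int) : Prop :=
  exists s, [/\ steps P t (State 0 (fun=> 0%R) w [::]) = Some s,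
                size P <= pc s & output s = w'].

Definition computes (P : program) (w w' : seq int) : Prop :=
  exists t, halts P w t w'.

Definition input_bits (w : seq int) : nat := \sum_(z <- w) bitlen z.

Definition poly_time_on (P : program) (dom : seq int -> Prop) : Prop :=
  exists c k : nat, forall w, dom w ->
    exists t w', halts P w t w' /\ t <= c * input_bits w ^ k.

(* Main.v *)
Require Import Defs.
From mathcomp Require Import all_boot all_order all_algebra.
From mathcomp Require Import finmap.
From mathcomp Require Import all_fingroup zify.
Set Implicit Arguments. Unset Strict Implicit. Unset Printing Implicit Defensive.
Import Order.TTheory GRing.Theory Num.Theory.

(* Let m be the maximum of sigma and rho. In every class of twins keep the first
   m + 1 vertices. If a class loses a vertex, all its kept vertices have a common
   neighbor, which has at most m neighbors in a dominating set D; so some kept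
   twin is outside D, and exchanging twins moves D inside the kept graph without
   changing its size. Conversely, a dominating set D of the kept graph extends to
   G as soon as every shortened class has a kept vertex outside D, because the
   deleted vertices then see D as that vertex does. This can only fail when G is a
   single shortened class contained in D; lowering the bound K below the number
   of kept vertices whenever a vertex is deleted excludes that case. The bound is
   also raised to 0 when it is negative, which keeps a no-instance since 0 is not
   in rho.

   The random access machine program is compiled from a structured language, and
   its runs are described on the first registers, used as scalar variables,
   followed by an array that only grows. *)

(** * Structured programs for the random access machine *)

Inductive cmd :=
| Nil
| Do (i : instr)
| Seq (c d : cmd)
| Unless (r : nat) (c : cmd)    (* skip c if 0 < X_r *)
| Repeat (c : cmd) (r : nat). (* at least once, and as long as 0 < X_r *)

Fixpoint len (c : cmd) : nat :=
  match c with
  | Nil => 0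
  | Do _ => 1
  | Seq c d => len c + len d
  | Unless _ c | Repeat c _ => (len c).+1
  end.

(** Jump targets are absolute, so [p] is the address of the first instruction. Each control
    structure costs one [JumpPos], the only jump of the machine. *)
Fixpoint compile (p : nat) (c : cmd) : program :=
  match c with
  | Nil => [::]
  | Do i => [:: i]
  | Seq c d => compile p c ++ compile (p + len c) d
  | Unless r c => JumpPos r (p + (len c).+1) :: compile p.+1 c
  | Repeat c r => rcons (compile p c) (JumpPos r p)
  end.

Lemma size_compile p c : size (compile p c) = len c.
Proof.
elim: c p => //= [c IHc d IHd p|r c IHc p|c IHc r p].
- by rewrite size_cat IHc IHd.
- by rewrite IHc.
- by rewrite size_rcons IHc.
Qed.

Record config := Config {
  vars : seq int;
  arr : seq int;
  inp : seq int;
  out : seq int }.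

(** The default value of [nth] forces all registers past the array to hold 0, as they do
    initially. *)
Definition represents (p : nat) (s : config) (st : state) : Prop :=
  [/\ pc st = p, forall i, reg st i = nth 0%R (vars s ++ arr s) i,
      input st = inp s & output st = out s].

(** Quantifying over the surrounding code makes runs composable. [T] is only an upper bound, so both
    outcomes of a test fit one statement. *)
Definition runs (c : cmd) (s : config) (T : nat) (s' : config) : Prop :=
  forall P pre post st, P = pre ++ compile (size pre) c ++ post ->
    represents (size pre) s st ->
    exists t st', [/\ t <= T, steps P t st = Some st' &
                      represents (size pre + len c) s' st'].

Lemma steps_add P t1 t2 s :
  steps P (t1 + t2) s = obind (steps P t2) (steps P t1 s).
Proof. by elim: t1 s => //= t1 IH s; case: (step P s) => //= s1; apply: IH. Qed.

Lemma steps1 P s : steps P 1 s = step P s.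
Proof. by rewrite /=; case: (step P s). Qed.

Lemma runs_le c s T T' s' : T <= T' -> runs c s T s' -> runs c s T' s'.
Proof.
move=> le h P pre post st eP rs; have [t [st' [ht e r]]] := h P pre post st eP rs.
by exists t, st'; split=> //; apply: leq_trans le.
Qed.

Lemma runs_nil s s' : s = s' -> runs Nil s 0 s'.
Proof. by move=> <- P pre post st _ rs; exists 0, st; rewrite addn0. Qed.

Lemma runs_seq c d s s1 s2 T1 T2 :
  runs c s T1 s1 -> runs d s1 T2 s2 -> runs (Seq c d) s (T1 + T2) s2.
Proof.
move=> h1 h2 P pre post st eP rs.
have eP1 : P = pre ++ compile (size pre) c ++ (compile (size pre + len c) d ++ post).
  by rewrite eP /= -!catA.
have [t1 [st1 [l1 e1 r1]]] := h1 _ _ _ _ eP1 rs.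
have eP2 : P = (pre ++ compile (size pre) c) ++
   compile (size (pre ++ compile (size pre) c)) d ++ post.
  by rewrite eP1 size_cat size_compile !catA.
have r1' : represents (size (pre ++ compile (size pre) c)) s1 st1.
  by rewrite size_cat size_compile.
have [t2 [st2 [l2 e2 r2]]] := h2 _ _ _ _ eP2 r1'.
exists (t1 + t2), st2; split; first exact: leq_add.
  by rewrite steps_add e1.
by move: r2; rewrite size_cat size_compile addnA.
Qed.

Lemma onth_middle (P pre post : program) (i : instr) :
  P = pre ++ i :: post -> onth P (size pre) = Some i.
Proof. by move=> ->; rewrite onth_cat ltnn subnn. Qed.

Lemma nth_set_vars (V A : seq int) r z k : r < size V ->
  nth 0%R (set_nth 0%R V r z ++ A) k = if k == r then z else nth 0%R (V ++ A) k.
Proof.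
move=> hr; rewrite !nth_cat size_set_nth (maxn_idPr hr) nth_set_nth /=.
by case: (k =P r) => [->|//]; rewrite hr.
Qed.

Lemma nth_var (V A : seq int) r : r < size V -> nth 0%R (V ++ A) r = nth 0%R V r.
Proof. by move=> h; rewrite nth_cat h. Qed.

Lemma runs_set (i : instr) r z V A w o :
  r < size V ->
  (forall P st, onth P (pc st) = Some i ->
     (forall i, reg st i = nth 0%R (V ++ A) i) -> step P st = Some (set_reg st r z)) ->
  runs (Do i) (Config V A w o) 1 (Config (set_nth 0%R V r z) A w o).
Proof.
move=> hr hs P pre post st eP [e1 e2 e3 e4].
exists 1, (set_reg st r z); split=> //.
  by rewrite steps1; apply: hs => //; rewrite e1; apply: (onth_middle eP).
split=> //=; first by rewrite e1 addn1.
by move=> k; rewrite nth_set_vars // e2.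
Qed.

Lemma runs_const r z V A w o : r < size V ->
  runs (Do (Const r z)) (Config V A w o) 1 (Config (set_nth 0%R V r z) A w o).
Proof. by move=> hr; apply: runs_set => // P st; rewrite /step => ->. Qed.

Lemma runs_add r j k V A w o : [&& r < size V, j < size V & k < size V] ->
  runs (Do (Add r j k)) (Config V A w o) 1
    (Config (set_nth 0%R V r (nth 0 V j + nth 0 V k)%R) A w o).
Proof.
case/and3P=> hr hj hk; apply: runs_set => // P st; rewrite /step => -> e.
by rewrite !e !nth_var.
Qed.

Lemma runs_sub r j k V A w o : [&& r < size V, j < size V & k < size V] ->
  runs (Do (Defs.Sub r j k)) (Config V A w o) 1
    (Config (set_nth 0%R V r (nth 0 V j - nth 0 V k)%R) A w o).
Proof.
case/and3P=> hr hj hk; apply: runs_set => // P st; rewrite /step => -> e.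
by rewrite !e !nth_var.
Qed.

Lemma runs_peek a r j V A w o : (r < size V) && (j < size V) ->
  nth 0%R V j = Posz (size V + a) ->
  runs (Do (Peek r j)) (Config V A w o) 1
    (Config (set_nth 0%R V r (nth 0%R A a)) A w o).
Proof.
case/andP=> hr hj ha; apply: runs_set => // P st; rewrite /step => -> e.
by rewrite !e nth_var // ha e nth_cat ltnNge leq_addr addKn.
Qed.

(* The only writes to the array that are needed extend it by one cell. *)
Lemma runs_poke i j V A w o : (i < size V) && (j < size V) ->
  nth 0%R V i = Posz (size V + size A) ->
  runs (Do (Poke i j)) (Config V A w o) 1 (Config V (rcons A (nth 0%R V j)) w o).
Proof.
case/andP=> hi hj ha P pre post st eP [e1 e2 e3 e4].
exists 1, (set_reg st (size V + size A) (nth 0%R V j)); split=> //.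
  by rewrite steps1 /step e1 (onth_middle eP) !e2 !nth_var // ha.
split=> //=; first by rewrite e1 addn1.
move=> k; rewrite e2 -rcons_cat nth_rcons size_cat.
case: (k =P _) => [->|ne]; first by rewrite ltnn.
by case: ltnP => // h; rewrite nth_default // size_cat.
Qed.

Lemma runs_read r z V A w o : r < size V ->
  runs (Do (Read r)) (Config V A (z :: w) o) 1 (Config (set_nth 0%R V r z) A w o).
Proof.
move=> hr P pre post st eP [e1 e2 e3 e4].
exists 1, (State (pc st).+1 [eta reg st with r |-> z] w (output st)); split=> //.
  by rewrite steps1 /step e1 (onth_middle eP) e3.
split=> //=; first by rewrite e1 addn1.
by move=> k; rewrite nth_set_vars // e2.
Qed.

Lemma runs_write r V A w o : r < size V ->
  runs (Do (Write r)) (Config V A w o) 1 (Config V A w (rcons o (nth 0%R V r))).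
Proof.
move=> hr P pre post st eP [e1 e2 e3 e4].
exists 1, (State (pc st).+1 (reg st) (input st) (rcons (output st) (reg st r))); split=> //.
  by rewrite steps1 /step e1 (onth_middle eP).
split=> //=; first by rewrite e1 addn1.
by rewrite e4 e2 nth_var.
Qed.

Lemma runs_unless r c s s' T : r < size (vars s) ->
  ((0 < nth 0 (vars s) r)%R -> s' = s) ->
  ((nth 0 (vars s) r <= 0)%R -> runs c s T s') ->
  runs (Unless r c) s T.+1 s'.
Proof.
move=> hr h1 h2 P pre post st eP rs; have [e1 e2 e3 e4] := rs.
have hstep : step P st = Some (State (if (0 < nth 0 (vars s) r)%R
    then size pre + (len c).+1 else (size pre).+1) (reg st) (input st) (output st)).
  by rewrite /step e1 (onth_middle eP) e2 nth_var.
case: (ltP 0%R (nth 0%R (vars s) r)) hstep => hv hstep.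
  exists 1; eexists; split=> //; first by rewrite steps1 hstep.
  by rewrite (h1 hv).
have eP' : P = (rcons pre (JumpPos r (size pre + (len c).+1))) ++
   compile (size (rcons pre (JumpPos r (size pre + (len c).+1)))) c ++ post.
  by rewrite size_rcons cat_rcons.
have [|t [st' [lt et rt]]] := h2 hv _ _ _
  (State (size pre).+1 (reg st) (input st) (output st)) eP'.
  by rewrite size_rcons.
exists t.+1, st'; split=> //=; first by rewrite hstep.
by move: rt; rewrite size_rcons addnS.
Qed.

(** [Inv k] describes the machine after [k] rounds. The loop register counts down from [N] to 0, and
    each round pays one extra step for the jump back. *)
Lemma runs_repeat (Inv : nat -> config) c r N T :
  0 < N ->
  (forall k, k <= N -> r < size (vars (Inv k)) /\
     nth 0%R (vars (Inv k)) r = Posz (N - k)) ->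
  (forall k, k < N -> runs c (Inv k) T (Inv k.+1)) ->
  runs (Repeat c r) (Inv 0) (N * T.+1) (Inv N).
Proof.
move=> N0 hr hI P pre post st eP.
have eP1 : P = pre ++ compile (size pre) c ++ (JumpPos r (size pre) :: post).
  by rewrite eP /= cat_rcons.
have eP2 : P = (pre ++ compile (size pre) c) ++ (JumpPos r (size pre) :: post).
  by rewrite eP1 catA.
have gen d k st0 : d.+1 + k = N -> represents (size pre) (Inv k) st0 ->
  exists t st', [/\ t <= d.+1 * T.+1, steps P t st0 = Some st' &
                   represents (size pre + (len c).+1) (Inv N) st'].
  elim: d k st0 => [|d IH] k st0 hk rs.
    have [|t [st1 [lt et [f1 f2 f3 f4]]]] := hI k _ _ _ _ _ eP1 rs; first lia.
    have eN : k.+1 = N by lia.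
    rewrite eN in f2 f3 f4.
    have [hr1 hr2] := hr N (leqnn N).
    exists (t + 1); eexists; split; [lia| |].
      rewrite steps_add et /= /step f1 -(size_compile (size pre) c) -size_cat.
      rewrite (onth_middle eP2) /= f2 nth_var // hr2 subnn /=; reflexivity.
    by split=> //=; rewrite ?hr2 ?subnn size_cat size_compile addnS.
  have [|t [st1 [lt et [f1 f2 f3 f4]]]] := hI k _ _ _ _ _ eP1 rs; first lia.
  have [|hr1 hr2] := hr k.+1; first lia.
  have [||t2 [st2 [lt2 et2 rt2]]] :=
    IH k.+1 (State (size pre) (reg st1) (input st1) (output st1)); [lia|by []|].
  exists (t + t2.+1), st2; split=> //; first by rewrite mulSn; lia.
  rewrite steps_add et /= /step f1 -(size_compile (size pre) c) -size_cat.
  rewrite (onth_middle eP2) /= f2 nth_var // hr2.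
  by have -> : (0 < Posz (N - k.+1))%R by lia.
move=> rs; case: N N0 gen {hr hI} => // N _ gen.
by apply: (gen N 0 st) rs; rewrite addn0.
Qed.

Lemma runs_computes c w s' T V :
  (forall z, z \in V -> z = 0%R) ->
  runs c (Config V [::] w [::]) T s' ->
  exists2 t, t <= T & halts (compile 0 c) w t (out s').
Proof.
move=> V0 h.
have [||t [st [lt et [e1 e2 e3 e4]]]] := h (compile 0 c) [::] [::]
   (State 0 (fun=> 0%R) w [::]).
- by rewrite /= cats0.
- split=> //= i; rewrite cats0; case: (ltnP i (size V)) => hi.
    by rewrite (V0 _ (mem_nth _ hi)).
  by rewrite nth_default.
exists t => //; exists st; split=> //.
by rewrite e1 size_compile.
Qed.

Definition block : seq cmd -> cmd := foldr Seq Nil.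

(** * The kernelization program *)

(* rSQ: n^2; rP: first free array cell; rU, rW: addresses of the rows of the
   adjacency matrix of the two vertices under comparison, or of the row that is
   written; rC: rank counter; rM: number of kept vertices. *)
Local Notation rZERO := 0.
Local Notation rONE := 1.
Local Notation rN := 2.
Local Notation rK := 3.
Local Notation rSQ := 4.
Local Notation rP := 5.
Local Notation rI := 6.
Local Notation rJ := 7.
Local Notation rX := 8.
Local Notation rS := 9.
Local Notation rD := 10.
Local Notation rE := 11.
Local Notation rA := 12.
Local Notation rB := 13.
Local Notation rU := 14.
Local Notation rW := 15.
Local Notation rV := 16.
Local Notation rC := 17.
Local Notation rM := 18.

(* The scalar variables live in registers 0, ..., 18, the array starts here. *)
Local Notation base := 19.

Local Notation Sub := Defs.Sub.

Definition read_matrix : cmd :=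
  block [:: Do (Add rI rN rZERO);
    Repeat (block [:: Do (Add rSQ rSQ rN); Do (Sub rI rI rONE)]) rI;
    Do (Add rI rSQ rZERO);
    Do (Const rP base);
    Repeat (block [:: Do (Read rD); Do (Poke rP rD); Do (Add rP rP rONE);
                      Do (Sub rI rI rONE); Do (Const rD 0%Z)]) rI].

(** A nonpositive difference, once added to [rS], is subtracted twice; so absolute values
    accumulate. Scratch registers are cleared in every round to keep the loop invariant explicit. *)
Definition row_distance : cmd :=
  Repeat (block [:: Do (Peek rD rA); Do (Peek rE rB); Do (Sub rD rD rE);
                    Do (Add rS rS rD);
                    Unless rD (block [:: Do (Sub rS rS rD); Do (Sub rS rS rD)]);
                    Do (Add rA rA rONE); Do (Add rB rB rONE); Do (Sub rX rX rONE);
                    Do (Const rD 0%Z); Do (Const rE 0%Z)]) rX.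

Definition count_types : cmd :=
  Repeat (block [:: Do (Const rS 0%Z);
                    Do (Add rA rU rZERO); Do (Add rB rW rZERO);
                    Do (Add rX rN rZERO);
                    row_distance;
                    Do (Add rA rU rV); Do (Peek rD rA);
                    Do (Sub rS rS rD); Do (Sub rS rS rD);
                    Unless rS (Do (Add rC rC rONE));
                    Do (Add rU rU rN); Do (Sub rJ rJ rONE);
                    Do (Const rS 0%Z); Do (Const rD 0%Z);
                    Do (Const rA 0%Z); Do (Const rB 0%Z)]) rJ.

(** [rJ] starts at [v + 1], so that [v] is compared with itself and all earlier vertices. The marks
    are appended to the array behind the matrix. *)
Definition mark_vertices (m : nat) : cmd :=
  block [:: Do (Add rI rN rZERO); Do (Const rW base);
    Repeat (block [:: Do (Const rC 0%Z); Do (Const rU base);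
                      Do (Add rJ rV rONE);
                      count_types;
                      Do (Const rD (Posz m.+1)); Do (Sub rD rC rD);
                      Do (Poke rP rD);
                      Unless rD (Do (Add rM rM rONE));
                      Do (Add rP rP rONE); Do (Add rW rW rN);
                      Do (Add rV rV rONE); Do (Sub rI rI rONE);
                      Do (Const rD 0%Z); Do (Const rC 0%Z);
                      Do (Const rU 0%Z)]) rI].

(** [1 - (n - M)], with [M] the number of kept vertices, is nonpositive exactly when a vertex is
    deleted. The later tests take the minimum with [K] and replace the result by 0 if [K] is
    nonpositive. *)
Definition write_bound : cmd :=
  block [:: Do (Sub rD rN rM); Do (Sub rD rONE rD); Do (Add rS rM rZERO);
            Unless rD (Do (Sub rS rS rONE));
            Do (Sub rD rK rS); Unless rD (Do (Add rS rK rZERO));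
            Unless rK (Do (Const rS 0%Z));
            Do (Write rM); Do (Write rS);
            Do (Const rS 0%Z); Do (Const rD 0%Z)].

Definition write_row : cmd :=
  Repeat (block [:: Do (Peek rS rB);
                    Unless rS (block [:: Do (Peek rC rW); Do (Write rC);
                                         Do (Const rC 0%Z)]);
                    Do (Add rB rB rONE); Do (Add rW rW rONE);
                    Do (Sub rJ rJ rONE); Do (Const rS 0%Z)]) rJ.

Definition write_matrix : cmd :=
  block [:: Do (Const rE base); Do (Add rE rE rSQ); Do (Add rA rE rZERO);
    Do (Add rI rN rZERO); Do (Const rU base);
    Repeat (block [:: Do (Peek rD rA);
                      Unless rD (block [:: Do (Add rJ rN rZERO);
                                           Do (Add rB rE rZERO);
                                           Do (Add rW rU rZERO);
                                           write_row;
                                           Do (Const rB 0%Z); Do (Const rW 0%Z)]);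
                      Do (Add rA rA rONE); Do (Add rU rU rN);
                      Do (Sub rI rI rONE); Do (Const rD 0%Z)]) rI].

Definition kernel (m : nat) : cmd :=
  block [:: Do (Read rN); Do (Read rK); Do (Const rONE 1%Z);
            read_matrix; mark_vertices m;
            Do (Const rW 0%Z); Do (Const rV 0%Z);
            write_bound; write_matrix].

(** * Arithmetic description of what the program computes *)

Section KernelSpec.

Variables (m n : nat) (K : int) (A : seq int).

Definition entry (u v : nat) : int := nth 0%R A (u * n + v).

(** For 0/1 rows this is the Hamming distance of their prefixes of length [k]. *)
Definition gap (u v k : nat) : int :=
  (\sum_(0 <= x < k) `|entry u x - entry v x|)%R.

Lemma gap0 u v : gap u v 0 = 0%R.
Proof. by rewrite /gap big_geq. Qed.

Lemma gap_recr u v k : gap u v k.+1 = (gap u v k + `|entry u k - entry v k|)%R.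
Proof. by rewrite /gap big_nat_recr. Qed.

(* The columns u and v of the rows u and v always differ if u and v are adjacent;
   twins are the pairs of vertices whose rows differ nowhere else. *)
Definition twin (u v : nat) : bool := (gap u v n - entry u v - entry u v <= 0)%R.

Definition ntwins (v k : nat) : nat := \sum_(0 <= u < k) twin u v.

(** For an adjacency matrix, the position of [v] among its twins, counted from 1. *)
Definition rank (v : nat) : nat := ntwins v v.+1.

(** Shifted so that [Unless], which runs its body on nonpositive registers, selects the kept
    vertices. *)
Definition mark (v : nat) : int := (Posz (rank v) - Posz m.+1)%R.

Definition kept (v : nat) : bool := (mark v <= 0)%R.

Definition nkept (k : nat) : nat := \sum_(0 <= v < k) kept v.

(* If a vertex is deleted, a dominating set never contains all kept vertices. *)
Definition bound : int :=
  let cap := (Posz (nkept n) - Posz (nkept n < n))%R in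
  if (K <= 0)%R then 0%R else if (K <= cap)%R then K else cap.

Definition row (u : nat) (k : nat) : seq int :=
  [seq entry u v | v <- iota 0 k & kept v].

Definition rows (k : nat) : seq int :=
  flatten [seq row u n | u <- iota 0 k & kept u].

End KernelSpec.

(** * Execution of the program, loop by loop *)

Lemma cons_congr (T : Type) (x y : T) s t : x = y -> s = t -> x :: s = y :: t.
Proof. by move=> -> ->. Qed.

Lemma config_congr V A w o V' A' w' o' :
  V = V' -> A = A' -> w = w' -> o = o' -> Config V A w o = Config V' A' w' o'.
Proof. by move=> -> -> -> ->. Qed.

Ltac config :=
  apply: config_congr => //;
  repeat (apply: cons_congr); try reflexivity;
  try lia.

Ltac next :=
  apply: runs_seq; [first
    [ by apply: runs_const | by apply: runs_add | by apply: runs_sub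
    | by apply: runs_read | by apply: runs_write] | rewrite /=].

Lemma runs_from c s s0 T s' : s = s0 -> runs c s0 T s' -> runs c s T s'.
Proof. by move=> ->. Qed.

Lemma runs_to c s T s0 s' : runs c s T s0 -> s0 = s' -> runs c s T s'.
Proof. by move=> h <-. Qed.

Lemma ntwins_recr n A v k :
  ntwins n A v k.+1 = ntwins n A v k + twin n A k v.
Proof. by rewrite /ntwins big_nat_recr. Qed.

Lemma nkept_recr m n A k : nkept m n A k.+1 = nkept m n A k + kept m n A k.
Proof. by rewrite /nkept big_nat_recr. Qed.

Lemma run_row_distance n K sq p i j u v U W V C M A w o : 0 < n ->
  let S k := Config [:: 0%R; 1%R; Posz n; K; sq; p; i; j; Posz (n - k);
    gap n A u v k; 0%R; 0%R; Posz (base + (u * n + k)); Posz (base + (v * n + k));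
    U; W; V; C; M] A w o in
  runs row_distance (S 0) (n * 14) (S n).
Proof.
move=> n0 S; apply: (runs_repeat (T := 13)) => // k hk; rewrite /S /=.
apply: runs_le; last first.
  apply: runs_seq; first by apply: (runs_peek (a := u * n + k)).
  rewrite /=.
  apply: runs_seq; first by apply: (runs_peek (a := v * n + k)).
  rewrite /= -/(entry n A u k) -/(entry n A v k).
  do 2 next.
  apply: runs_seq.
    (* Both outcomes of the test meet in this configuration: a positive difference already equals
       its absolute value. *)
    apply: (runs_unless (s' := Config [:: 0%R; 1%R; Posz n; K; sq; p; i; j;
      Posz (n - k); gap n A u v k.+1; (entry n A u k - entry n A v k)%R;
      entry n A v k; Posz (base + (u * n + k)); Posz (base + (v * n + k));
      U; W; V; C; M] A w o)) => //= h.
      by rewrite gap_recr; config.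
    by do 2 next; apply: runs_nil; rewrite gap_recr; config.
  rewrite /=; do 5 next.
  by apply: runs_nil; config.
by [].
Qed.

Lemma run_count_types n K sq p i v M A w o : 0 < n ->
  let S k := Config [:: 0%R; 1%R; Posz n; K; sq; p; i; Posz (v.+1 - k); 0%R; 0%R;
    0%R; 0%R; 0%R; 0%R; Posz (base + k * n); Posz (base + v * n); Posz v;
    Posz (ntwins n A v k); M] A w o in
  runs count_types (S 0) (v.+1 * (n * 14 + 18)) (S v.+1).
Proof.
move=> n0 S; rewrite -[18]/(17.+1) addnS.
apply: (runs_repeat (T := n * 14 + 17)) => // k hk; rewrite /S /=.
apply: runs_le; last first.
  do 4 next.
  apply: runs_seq.
    apply: runs_from; last exact: (@run_row_distance n K sq p i (Posz (v.+1 - k))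
      k v (Posz (base + k * n)) (Posz (base + v * n)) (Posz v)
      (Posz (ntwins n A v k)) M A w o n0).
    by rewrite gap0; config.
  rewrite /=; next.
  apply: runs_seq; first by apply: (runs_peek (a := k * n + v)) => //=; lia.
  rewrite /= -/(entry n A k v).
  do 2 next.
  apply: runs_seq.
    apply: (runs_unless (s' := Config [:: 0%R; 1%R; Posz n; K; sq; p; i;
      Posz (v.+1 - k); Posz (n - n); (gap n A k v n - entry n A k v - entry n A k v)%R;
      entry n A k v; 0%R; (Posz (base + k * n) + Posz v)%R;
      Posz (base + (v * n + n));
      Posz (base + k * n); Posz (base + v * n); Posz v;
      Posz (ntwins n A v k.+1); M] A w o)) => //= h.
      by rewrite ntwins_recr /twin; config.
    apply: runs_to; first exact: runs_add.
    by rewrite /= ntwins_recr /twin; config.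
  rewrite /=; do 6 next.
  by apply: runs_nil; config.
lia.
Qed.

Lemma run_read_matrix n K A o : 0 < n -> size A = n * n ->
  runs read_matrix
    (Config ([:: 0%R; 1%R; Posz n; K] ++ nseq 15 0%R) [::] A o)
    (n * 3 + n * n * 6 + 3)
    (Config ([:: 0%R; 1%R; Posz n; K; Posz (n * n); Posz (base + n * n)]
             ++ nseq 13 0%R) A [::] o).
Proof.
move=> n0 sA.
pose S1 k := Config ([:: 0%R; 1%R; Posz n; K; Posz (k * n); 0%R; Posz (n - k)]
  ++ nseq 12 0%R) [::] A o.
have r1 : runs (Repeat (block [:: Do (Add rSQ rSQ rN); Do (Sub rI rI rONE)]) rI)
  (S1 0) (n * 3) (S1 n).
  apply: (runs_repeat (T := 2)) => // k hk; rewrite /S1 /=.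
  apply: runs_le; last by do 2 next; apply: runs_nil; config.
  by [].
pose S2 k := Config ([:: 0%R; 1%R; Posz n; K; Posz (n * n); Posz (base + k);
  Posz (n * n - k)] ++ nseq 12 0%R) (take k A) (drop k A) o.
have r2 : runs (Repeat (block [:: Do (Read rD); Do (Poke rP rD);
    Do (Add rP rP rONE); Do (Sub rI rI rONE); Do (Const rD 0%Z)]) rI)
  (S2 0) (n * n * 6) (S2 (n * n)).
  apply: (runs_repeat (T := 5)) => // [|k hk]; first by rewrite muln_gt0 n0.
  rewrite /S2 /= (drop_nth 0%R) ?sA //.
  apply: runs_le; last first.
    next.
    apply: runs_seq; first by apply: runs_poke; rewrite //= size_take sA hk.
    rewrite /=; do 3 next.
    by apply: runs_nil; config; rewrite (take_nth 0%R) ?sA.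
  by [].
apply: runs_le; last first.
  next.
  apply: runs_seq; first by apply: runs_from; last exact: r1; config.
  rewrite /S1 /=; do 2 next.
  apply: runs_seq.
    by apply: runs_from; last exact: r2; rewrite /S2 take0 drop0; config.
  by apply: runs_nil; rewrite /S2 -sA take_size drop_size; config.
lia.
Qed.

Definition marks m n A k : seq int := [seq mark m n A v | v <- iota 0 k].

Lemma marksS m n A k : marks m n A k.+1 = rcons (marks m n A k) (mark m n A k).
Proof. by rewrite /marks -addn1 iotaD map_cat cats1. Qed.

Lemma size_marks m n A k : size (marks m n A k) = k.
Proof. by rewrite size_map size_iota. Qed.

Lemma nth_marks m n A k v : v < k -> nth 0%R (marks m n A k) v = mark m n A v.
Proof. by move=> h; rewrite (nth_map 0) ?size_iota // nth_iota. Qed.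

(** The twin tests run on an array that already ends with the marks of earlier vertices; inside the
    matrix it agrees with [A]. *)
Lemma entry_cat n A F u v : size A = n * n -> u < n -> v < n ->
  entry n (A ++ F) u v = entry n A u v.
Proof. by move=> sA hu hv; rewrite /entry nth_cat sA ifT //; nia. Qed.

Lemma ntwins_cat n A F v k : size A = n * n -> v < n -> k <= n ->
  ntwins n (A ++ F) v k = ntwins n A v k.
Proof.
move=> sA hv hk; apply: eq_big_nat => u /andP[_ hu].
have hu' : u < n by lia.
suff -> : twin n (A ++ F) u v = twin n A u v by [].
rewrite /twin !entry_cat //; suff -> : gap n (A ++ F) u v n = gap n A u v n by [].
by apply: eq_big_nat => x /andP[_ hx]; rewrite !entry_cat.
Qed.

Lemma run_mark_vertices m n K A w o : 0 < n -> size A = n * n ->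
  let S k := Config [:: 0%R; 1%R; Posz n; K; Posz (n * n); Posz (base + (n * n + k));
    Posz (n - k); 0%R; 0%R; 0%R; 0%R; 0%R; 0%R; 0%R; 0%R; Posz (base + k * n);
    Posz k; 0%R; Posz (nkept m n A k)] (A ++ marks m n A k) w o in
  runs (mark_vertices m)
    (Config ([:: 0%R; 1%R; Posz n; K; Posz (n * n); Posz (base + n * n)]
             ++ nseq 13 0%R) A w o)
    (n * (n * (n * 14 + 18) + 17) + 2) (S n).
Proof.
move=> n0 sA S.
apply: runs_le; last first.
  do 2 next.
  apply: runs_seq; last exact: runs_nil.
  apply: (@runs_from _ _ (S 0)); first by rewrite /S /nkept big_geq // cats0; config.
  apply: (runs_repeat (T := n * (n * 14 + 18) + 16)) => // k hk; rewrite /S /=.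
  apply: runs_le; last first.
    do 3 next.
    apply: runs_seq.
      apply: runs_from; last exact: (@run_count_types n K (Posz (n * n))
        (Posz (base + (n * n + k))) (Posz (n - k)) k (Posz (nkept m n A k))
        (A ++ marks m n A k) w o n0).
      by rewrite /ntwins big_geq //; config.
    rewrite /= ntwins_cat // -/(rank n A k); do 2 next.
    apply: runs_seq.
      by apply: runs_poke; rewrite //= size_cat size_marks sA; lia.
    rewrite /= -/(mark m n A k) rcons_cat -marksS.
    apply: runs_seq.
      apply: (runs_unless (s' := Config [:: 0%R; 1%R; Posz n; K; Posz (n * n);
        Posz (base + (n * n + k)); Posz (n - k); Posz (k.+1 - k.+1); 0%R; 0%R;
        mark m n A k; 0%R; 0%R; 0%R; Posz (base + k.+1 * n); Posz (base + k * n);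
        Posz k; Posz (rank n A k); Posz (nkept m n A k.+1)]
        (A ++ marks m n A k.+1) w o)) => //= h.
        by rewrite nkept_recr /kept; config.
      apply: runs_to; first exact: runs_add.
      by rewrite /= nkept_recr /kept; config.
    rewrite /=; do 7 next.
    by apply: runs_nil; config.
  by nia.
lia.
Qed.

Lemma nkept_le m n A k : nkept m n A k <= k.
Proof.
elim: k => [|k IH]; first by rewrite /nkept big_geq.
by rewrite nkept_recr; case: kept => /=; lia.
Qed.

Lemma run_write_bound m n K sq p B0 A w o :
  let S o := Config [:: 0%R; 1%R; Posz n; K; sq; p; 0%R; 0%R; 0%R; 0%R; 0%R; 0%R;
    0%R; 0%R; 0%R; 0%R; 0%R; 0%R; Posz (nkept m n A n)] B0 w o in
  runs write_bound (S o) 14 (S (o ++ [:: Posz (nkept m n A n); bound m n K A])).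
Proof.
move=> S; rewrite /S.
have hle := nkept_le m n A n.
set M := nkept m n A n; set cap := (Posz M - Posz (M < n))%R.
apply: runs_le; last first.
  do 3 next.
  apply: runs_seq.
    apply: (runs_unless (s' := Config [:: 0%R; 1%R; Posz n; K; sq; p; 0%R; 0%R; 0%R;
      cap; (1 - (Posz n - Posz M))%R; 0%R; 0%R; 0%R; 0%R; 0%R; 0%R; 0%R; Posz M]
      B0 w o)) => //= h.
      by rewrite /cap; config.
    by apply: runs_to; [exact: runs_sub|rewrite /= /cap; config].
  rewrite /=; next.
  apply: runs_seq.
    apply: (runs_unless (s' := Config [:: 0%R; 1%R; Posz n; K; sq; p; 0%R; 0%R; 0%R;
      (if K <= cap then K else cap)%R; (K - cap)%R; 0%R; 0%R; 0%R; 0%R; 0%R; 0%R;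
      0%R; Posz M] B0 w o)) => //= h.
      by rewrite ifF; [config|lia].
    by apply: runs_to; [exact: runs_add|rewrite /= ifT; [config|lia]].
  apply: runs_seq.
    apply: (runs_unless (s' := Config [:: 0%R; 1%R; Posz n; K; sq; p; 0%R; 0%R; 0%R;
      bound m n K A; (K - cap)%R; 0%R; 0%R; 0%R; 0%R; 0%R; 0%R;
      0%R; Posz M] B0 w o)) => //= h.
      by rewrite /bound ifF; [config|lia].
    by apply: runs_to; [exact: runs_const|rewrite /= /bound h; config].
  rewrite /=; do 4 next.
  by apply: runs_nil; config; rewrite -!cats1 -catA.
by [].
Qed.

Lemma rowS m n A u k :
  row m n A u k.+1 = row m n A u k ++ if kept m n A k then [:: entry n A u k] else [::].
Proof.
rewrite /row -addn1 iotaD filter_cat map_cat /= add0n.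
by case: kept.
Qed.

Lemma rowsS m n A k :
  rows m n A k.+1 = rows m n A k ++ if kept m n A k then row m n A k n else [::].
Proof.
rewrite /rows -addn1 iotaD filter_cat map_cat flatten_cat /= add0n.
by case: kept; rewrite //= cats0.
Qed.

Lemma run_write_row m n K sq p i d e a u V M A w o :
  0 < n -> size A = n * n -> u < n ->
  let S k := Config [:: 0%R; 1%R; Posz n; K; sq; p; i; Posz (n - k); 0%R; 0%R; d; e; a;
    Posz (base + (n * n + k)); Posz (base + u * n); Posz (base + (u * n + k)); V; 0%R; M]
    (A ++ marks m n A n) w (o ++ row m n A u k) in
  runs write_row (S 0) (n * 10) (S n).
Proof.
move=> n0 sA hu S.
apply: (runs_repeat (T := 9)) => // k hk; rewrite /S /=.
apply: runs_le; last first.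
  apply: runs_seq; first by apply: (runs_peek (a := n * n + k)).
  rewrite /= nth_cat sA ltnNge leq_addr addKn nth_marks //=.
  apply: runs_seq.
    apply: (runs_unless (s' := Config [:: 0%R; 1%R; Posz n; K; sq; p; i; Posz (n - k);
      0%R; mark m n A k; d; e; a; Posz (base + (n * n + k)); Posz (base + u * n);
      Posz (base + (u * n + k)); V; 0%R; M]
      (A ++ marks m n A n) w (o ++ row m n A u k.+1))) => //= h.
      by rewrite rowS ifF ?cats0 // /kept; lia.
    apply: runs_seq; first by apply: (runs_peek (a := u * n + k)).
    rewrite /= -/(entry n _ u k) entry_cat //; do 2 next.
    apply: runs_nil; config.
    by rewrite rowS ifT // catA cats1.
  rewrite /=; do 4 next.
  by apply: runs_nil; config.
by [].
Qed.

Lemma run_write_matrix m n K p M A w o : 0 < n -> size A = n * n ->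
  exists V, runs write_matrix
   (Config [:: 0%R; 1%R; Posz n; K; Posz (n * n); p; 0%R; 0%R; 0%R; 0%R; 0%R; 0%R;
      0%R; 0%R; 0%R; 0%R; 0%R; 0%R; M] (A ++ marks m n A n) w o)
   (n * (n * 10 + 12) + 5)
   (Config V (A ++ marks m n A n) w (o ++ rows m n A n)).
Proof.
move=> n0 sA.
pose S k := Config [:: 0%R; 1%R; Posz n; K; Posz (n * n); p; Posz (n - k); 0%R; 0%R;
  0%R; 0%R; Posz (base + n * n); Posz (base + (n * n + k)); 0%R; Posz (base + k * n);
  0%R; 0%R; 0%R; M] (A ++ marks m n A n) w (o ++ rows m n A k).
exists (vars (S n)).
apply: runs_le; last first.
  do 5 next.
  apply: runs_seq; last exact: runs_nil.
  apply: (@runs_from _ _ (S 0)); first by rewrite /S; config; rewrite cats0.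
  apply: (runs_repeat (T := n * 10 + 11)) => // k hk; rewrite /S /=.
  apply: runs_le; last first.
    apply: runs_seq; first by apply: (runs_peek (a := n * n + k)).
    rewrite /= nth_cat sA ltnNge leq_addr addKn nth_marks //=.
    apply: runs_seq.
      apply: (runs_unless (s' := Config [:: 0%R; 1%R; Posz n; K; Posz (n * n); p;
        Posz (n - k); 0%R; 0%R; 0%R; mark m n A k; Posz (base + n * n);
        Posz (base + (n * n + k)); 0%R; Posz (base + k * n);
        0%R; 0%R; 0%R; M] (A ++ marks m n A n) w (o ++ rows m n A k.+1))) => //= h.
        by rewrite rowsS ifF ?cats0 // /kept; lia.
      do 3 next.
      apply: runs_seq.
        apply: runs_from; last exact: (@run_write_row m n K (Posz (n * n)) p
          (Posz (n - k)) (mark m n A k) (Posz (base + n * n))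
          (Posz (base + (n * n + k))) k 0%R M A w (o ++ rows m n A k) n0 sA hk).
        by config; rewrite cats0.
      rewrite /=; do 2 next.
      apply: runs_nil; config.
      by rewrite rowsS ifT // catA.
    rewrite /=; do 4 next.
    by apply: runs_nil; config.
  lia.
lia.
Qed.

(** The time is cubic: each of the at most [n * n] comparisons of two vertices scans two rows of
    length [n]. The constant does not depend on [m]. *)
Lemma run_kernel m n K A : 0 < n -> size A = n * n ->
  exists2 t, t <= 100 * (n.+1 * n.+1 * n.+1) &
    halts (compile 0 (kernel m)) [:: Posz n, K & A] t
      [:: Posz (nkept m n A n), bound m n K A & rows m n A n].
Proof.
move=> n0 sA.
have [V r] := @run_write_matrix m n K (Posz (base + (n * n + n)))
  (Posz (nkept m n A n)) A [::] [:: Posz (nkept m n A n); bound m n K A] n0 sA.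
have [||t ht h] := @runs_computes (kernel m) [:: Posz n, K & A]
  (Config V (A ++ marks m n A n) [::]
    [:: Posz (nkept m n A n), bound m n K A & rows m n A n])
  (100 * (n.+1 * n.+1 * n.+1)) (nseq 19 0%R).
- by move=> z; rewrite mem_nseq => /eqP.
- apply: runs_le; last first.
    do 3 next.
    apply: runs_seq; first exact: (@run_read_matrix n K A [::] n0 sA).
    apply: runs_seq; first exact: (@run_mark_vertices m n K A [::] [::] n0 sA).
    rewrite /=; do 2 next.
    apply: runs_seq.
      apply: runs_from; last exact: (@run_write_bound m n K (Posz (n * n))
        (Posz (base + (n * n + n))) (A ++ marks m n A n) A [::] [::]).
      by config.
    rewrite /=.
    by apply: runs_seq; [exact: r | exact: runs_nil].
  nia.
- by exists t.
Qed.

(** * Twins and the reduced graph *)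

Section Twins.

Variable G : sgraph.
Implicit Types u v w x y : vertex G.

Definition twins u v : bool :=
  [forall x, (x != u) ==> (x != v) ==> (adj u x == adj v x)].

Lemma twinsP u v :
  reflect (forall x, x != u -> x != v -> adj u x = adj v x) (twins u v).
Proof.
apply: (iffP forallP) => h x; first by move=> xu xv; have := h x; rewrite xu xv => /eqP.
by apply/implyP => xu; apply/implyP => xv; rewrite h.
Qed.

Lemma same_typeP u v : same_type u v <-> twins u v.
Proof.
split=> [/setP h|/twinsP h].
  by apply/twinsP => x xu xv; have := h x; rewrite !inE xu xv.
apply/setP => x; rewrite !inE.
case: (x =P u) => [->|/eqP xu]; first by rewrite adj_irr andbF.
case: (x =P v) => [->|/eqP xv]; first by rewrite adj_irr.
by rewrite h.
Qed.

Lemma twins_refl u : twins u u.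
Proof. exact/twinsP. Qed.

Lemma twins_sym u v : twins u v = twins v u.
Proof. by apply/twinsP/twinsP => h x xu xv; rewrite h. Qed.

Lemma twins_trans v u w : twins u v -> twins v w -> twins u w.
Proof.
have [->//|nuv] := eqVneq u v; have [->//|nvw] := eqVneq v w.
have [->|nuw] := eqVneq u w; first by rewrite twins_refl.
move=> /twinsP uv /twinsP vw; apply/twinsP => x xu xw.
(* At the middle vertex [v] the chain breaks; there the equality goes around the triangle:
   [adj v u = adj w u = adj u w = adj v w]. *)
have [->|xv] := eqVneq x v; last by rewrite uv // vw.
rewrite (adj_sym u) vw // (adj_sym w) (uv w) 1?eq_sym //.
by rewrite adj_sym.
Qed.

Definition twin_class v : {set vertex G} := [set u | twins u v].

Lemma twin_class_eq u v : twins u v -> twin_class u = twin_class v.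
Proof.
move=> uv; apply/setP => x; rewrite !inE; apply/idP/idP => h.
  exact: twins_trans uv.
by apply: twins_trans h _; rewrite twins_sym.
Qed.

(** Swapping twins is an automorphism, which is the basis of the exchange argument. *)
Lemma twins_aut u v x y : twins u v ->
  adj (tperm u v x) (tperm u v y) = adj x y.
Proof.
move=> /twinsP h; case: tpermP => [->|->|/eqP xu /eqP xv];
  case: tpermP => [->|->|/eqP yu /eqP yv] //; rewrite ?adj_irr //.
- by rewrite adj_sym.
- by rewrite h.
- by rewrite adj_sym.
- by rewrite h.
- by rewrite adj_sym -h // adj_sym.
- by rewrite adj_sym h // adj_sym.
Qed.

Variable m : nat.

(** Counting the members of the class up to [v] selects the first [m.+1] of each class, in agreement
    with [rank]. *)
Definition keep : {set vertex G} :=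
  [set v | #|[set u in twin_class v | u <= v]| <= m.+1].

Lemma card_keep_twins (C : {set vertex G}) :
  {in C &, forall u v, twins u v} -> #|C :&: keep| <= m.+1.
Proof.
move=> hC; case: (set_0Vmem (C :&: keep)) => [->|[v0 h0]]; first by rewrite cards0.
(* For the largest kept vertex [v] of [C], all of [C :&: keep] is among the at most [m.+1] twins
   counted at [v]. *)
have [v /setIP[vC]] := arg_maxnP (fun v : vertex G => val v) h0.
rewrite inE => hv hmax; apply: leq_trans hv; apply/subset_leq_card/subsetP => u hu.
by rewrite !inE; case/setIP: (hu) => uC _; rewrite hC //=; apply: hmax.
Qed.

(** The first deleted vertex of the class is preceded by more than [m] members, all of them kept. *)
Lemma card_twin_class_keep v : v \notin keep -> m < #|twin_class v :&: keep|.
Proof.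
move=> hv; pose P := [pred w | (w \in twin_class v) && (w \notin keep)].
have Pv : P v by rewrite /= hv inE twins_refl.
have [w /andP[]] := arg_minnP (fun v : vertex G => val v) Pv.
rewrite [w \in _]inE => wv; rewrite inE (twin_class_eq wv) -ltnNge => hw hmin.
have hlt : m < #|[set u in twin_class v | u <= w] :\ w|.
  by move: hw; rewrite (cardsD1 w) !inE wv leqnn.
apply: leq_trans hlt _; apply/subset_leq_card/subsetP => u.
rewrite 2!inE => /andP[uw]; rewrite inE => /andP[uv leuw].
rewrite in_setI uv /=; apply/negPn/negP => hu.
have /hmin : P u by rewrite /= uv hu.
move=> lewu; case/eqP: uw; apply/val_inj/eqP.
by rewrite eqn_leq leuw.
Qed.

Lemma keep_twin v : exists2 u, u \in keep & twins u v.
Proof.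
have [hv|/card_twin_class_keep h] := boolP (v \in keep).
  by exists v => //; apply: twins_refl.
have /card_gt0P[u] : 0 < #|twin_class v :&: keep| by apply: leq_ltn_trans h.
by rewrite !inE => /andP[uv hu]; exists u; rewrite ?inE.
Qed.

Lemma keep_nonempty : 0 < nverts G -> 0 < #|keep|.
Proof.
move=> n0; have [u hu _] := keep_twin (Ordinal n0).
by apply/card_gt0P; exists u.
Qed.

(** Each part of the partition consists of pairwise twins, so it holds at most [m.+1] kept
    vertices. *)
Lemma card_keep b : has_nbr_diversity G b -> #|keep| <= m.+1 * b.
Proof.
case=> Q [hQ hb hC].
have -> : #|keep| = \sum_(C in Q) #|C :&: keep|.
  rewrite -sum1_card -[keep]setTI.
  under eq_bigl => x do rewrite in_setI.
  rewrite (set_partition_big_cond _ hQ); apply: eq_bigr => C _.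
  by rewrite -sum1_card; apply: eq_bigl => x; rewrite !inE.
apply: (@leq_trans (\sum_(C in Q) m.+1)).
  apply: leq_sum => C CQ; apply: card_keep_twins => u v uC vC.
  by apply/same_typeP; apply: hC uC vC.
by rewrite sum_nat_const mulnC leq_mul2l hb orbT.
Qed.

Hypothesis conG : connected G.

(** An outside neighbor of one member is adjacent to all members. Without one, the class is closed
    under adjacency, and connectedness makes it the whole graph. *)
Lemma twin_class_nbr v : 
  (exists2 w, w \notin twin_class v & twin_class v \subset nbr w) \/
  twin_class v = setT.
Proof.
case: (boolP [exists x in twin_class v, exists w, (w \notin twin_class v) && adj x w]).
  case/exists_inP=> x xv /existsP[w /andP[wv xw]]; left; exists w => //.
  apply/subsetP => y yv; rewrite inE adj_sym.
  have [->//|nyx] := eqVneq y x.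
  have /twinsP h : twins y x.
    by move: xv yv; rewrite !inE => xv yv; apply: twins_trans yv _; rewrite twins_sym.
  by rewrite h //; apply: contraNneq wv => ->.
move=> hn; right; apply/setP => y; rewrite in_setT.
have cl : closed (@adj G) (mem (twin_class v)).
  apply: intro_closed => [|x w xw xv]; first by apply: sym_connect_sym; apply: adj_sym.
  apply: contraNT hn => wv; apply/exists_inP; exists x => //.
  by apply/existsP; exists w; rewrite wv.
by have /= := closed_connect cl (conG.2 v y); rewrite [v \in _]inE twins_refl => <-.
Qed.

Lemma keep_twins_nbr v : v \notin keep ->
  exists w, twin_class v :&: keep \subset nbr w.
Proof.
move=> hv; have [[w _ hw]|hT] := twin_class_nbr v.
  by exists w; apply: subset_trans hw; apply: subsetIl.
(* If all vertices are twins, the deleted [v] itself serves: a path to the kept [u] gives it a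
   neighbor [x], and every kept vertex is a twin of [x]. *)
exists v; have [u uk _] := keep_twin v.
have nvu : v != u by apply: contraNneq hv => ->.
have /connectP[[|x p] /= hp eu] := conG.2 v u; first by rewrite eu eqxx in nvu.
case/andP: hp => vx _; apply/subsetP => y /setIP[_ yk]; rewrite inE.
have nyv : v != y by apply: contraNneq hv => ->.
have [->//|nyx] := eqVneq y x.
have /twinsP h : twins y x.
  have : y \in twin_class v by rewrite hT inE.
  have : x \in twin_class v by rewrite hT inE.
  by rewrite !inE => xv yv; apply: twins_trans yv _; rewrite twins_sym.
have nvx : v != x by apply: contraTneq vx => <-; rewrite adj_irr.
by rewrite adj_sym h // adj_sym.
Qed.

(** The common neighbor is replaced by a kept twin of it, because in the converse direction
    domination is known at kept vertices only. *)
Lemma keep_twin_class_nbr v : v \notin keep ->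
  (exists2 w, w \in keep & twin_class v :&: keep \subset nbr w) \/
  twin_class v = setT.
Proof.
move=> hv; have [[w wv hw]|] := twin_class_nbr v; last by right.
left; have [r rk rw] := keep_twin w; exists r => //.
apply/subsetP => y /setIP[yv _]; have /subsetP/(_ y yv) := hw; rewrite !inE.
have yw : y != w by apply: contraNneq wv => <-.
have yr : y != r.
  apply: contraNneq wv => e; move: yv; rewrite !inE e => rv.
  by apply: twins_trans rv; rewrite twins_sym.
by move/twinsP: rw => h; rewrite h.
Qed.

End Twins.

(** * The graph induced on the kept vertices *)

Definition induced (G : sgraph) (S : {set vertex G}) : sgraph :=
  @SGraph #|S| (fun i j => adj (enum_val i) (enum_val j))
    (fun i j => adj_sym (enum_val i) (enum_val j))
    (fun i => adj_irr (enum_val i)).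

(** Sending each vertex to a kept twin, and kept vertices to themselves, maps an edge to an edge or
    to a single vertex; so walks of [G] project to walks among kept vertices. *)
Lemma connected_induced_keep (G : sgraph) m :
  connected G -> connected (induced (keep G m)).
Proof.
move=> [n0 con]; split; first exact: keep_nonempty.
pose rep v := if v \in keep G m then v else odflt v [pick u in keep G m | twins u v].
have repP v : (rep v \in keep G m) && twins (rep v) v.
  rewrite /rep; case: ifP => [->|_]; first exact: twins_refl.
  case: pickP => [u //|h]; have [u uk uv] := keep_twin m v.
  by have := h u; rewrite uk uv.
have repE v : v \in keep G m -> rep v = v by rewrite /rep => ->.
have edge x y : adj x y -> rep x != rep y -> adj (rep x) (rep y).
  move=> xy nxy; have /andP[_ /twinsP hx] := repP x; have /andP[_ /twinsP hy] := repP y.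
  have nyx : y != x by apply: contraTneq xy => ->; rewrite adj_irr.
  (* Twins agree only away from themselves. If [y] is [rep x], it is kept and the two
     representatives coincide. *)
  have [e|ne] := eqVneq y (rep x).
    have yk : y \in keep G m by rewrite e; case/andP: (repP x).
    by rewrite (repE _ yk) e eqxx in nxy.
  have [e|ne2] := eqVneq (rep x) y; first by rewrite e eqxx in ne.
  by rewrite adj_sym hy // adj_sym hx.
have pth p x : path (@adj G) x p -> forall i j : vertex (induced (keep G m)),
    enum_val i = rep x -> enum_val j = rep (last x p) ->
    connect (@adj (induced (keep G m))) i j.
  elim: p x => [|y p IH] x /=.
    by move=> _ i j ei ej; rewrite (enum_val_inj (etrans ei (esym ej))) connect0.
  case/andP=> xy hp i j ei ej; have /andP[ky _] := repP y.
  pose k := enum_rank_in ky (rep y).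
  have ek : enum_val k = rep y by rewrite enum_rankK_in.
  apply: connect_trans (IH y hp k j ek ej).
  have [e|ne] := eqVneq (rep x) (rep y).
    by rewrite (@enum_val_inj _ _ i k) ?connect0 // ei ek.
  by apply: connect1; rewrite /= ei ek edge.
move=> i j; have /connectP[p hp ej] := con (enum_val i) (enum_val j).
by apply: (pth p (enum_val i)) => //; rewrite -?ej repE // enum_valP.
Qed.

(** Expresses domination in the induced graph by a subset of [G], tested at the vertices of [S]
    only. *)
Lemma dominating_induced sigma rho (G : sgraph) (S : {set vertex G})
    (D : {set vertex (induced S)}) :
  let E := [set enum_val i | i in D] in
  dominating sigma rho D <-> forall x, x \in S ->
    if x \in E then #|nbr x :&: E| \in sigma else #|nbr x :&: E| \in rho.
Proof.
move=> E.
have memE i : (enum_val i \in E) = (i \in D) by rewrite mem_imset //; apply: enum_val_inj.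
have cE i : #|nbr (enum_val i) :&: E| = #|@nbr (induced S) i :&: D|.
  rewrite -(card_imset _ (@enum_val_inj _ (mem S))); apply: eq_card => x.
  apply/idP/imsetP => [/setIP[]|[j /setIP[hj jD] ->]].
    rewrite inE => h /imsetP[j jD e]; exists j => //.
    by rewrite in_setI jD andbT inE /= -e.
  by rewrite in_setI memE jD andbT; move: hj; rewrite !inE.
split=> [[h1 h2] x xS|h].
  rewrite -[x](enum_rankK_in xS xS) memE cE.
  by case: ifP => [/h1//|/negbT/h2].
by split=> i hi; have := h _ (enum_valP i); rewrite memE cE ?hi ?(negPf hi).
Qed.

(** * Moving dominating sets between the graph and its kept part *)

Section Domination.

Variables (sigma rho : {pred nat}) (G : sgraph) (m : nat).
Hypotheses (sigma_le : forall i, i \in sigma -> i <= m)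
           (rho_le : forall i, i \in rho -> i <= m)
           (rho0 : 0 \notin rho) (conG : connected G).

Local Notation keep := (keep G m).
Implicit Types D E : {set vertex G}.

Lemma dominating_card D v : dominating sigma rho D -> #|nbr v :&: D| <= m.
Proof. by case=> h1 h2; have [/h1/sigma_le|/h2/rho_le] := boolP (v \in D). Qed.

(** The kept twins of [v] number more than [m] and share a neighbor, which sees at most [m] vertices
    of [D]; so one of them is outside [D]. *)
Lemma dominating_keep_twin D v : dominating sigma rho D -> v \notin keep ->
  exists2 u, u \in keep :\: D & twins v u.
Proof.
move=> hD hv; have [w hw] := keep_twins_nbr conG hv.
have /subsetPn[u] : ~~ (twin_class v :&: keep \subset D).
  apply/negP => hs; have := card_twin_class_keep hv; rewrite ltnNge => /negP; apply.
  apply: leq_trans (dominating_card w hD).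
  by apply: subset_leq_card; rewrite subsetI hw.
case/setIP=> vu uk uD; exists u; first by rewrite in_setD uD.
by rewrite twins_sym; rewrite inE in vu.
Qed.

Lemma dominating_aut (p : {perm vertex G}) D :
  (forall x y, adj (p x) (p y) = adj x y) ->
  dominating sigma rho D -> dominating sigma rho (p @: D).
Proof.
move=> hp [h1 h2].
have cE x : #|nbr (p x) :&: (p @: D)| = #|nbr x :&: D|.
  rewrite -[RHS](card_imset _ (@perm_inj _ p)) imsetI; last by move=> ? ? _ _; apply: perm_inj.
  congr #|pred_of_set (_ :&: _)|; apply/setP => y.
  rewrite -(permKV p y) mem_imset; last exact: perm_inj.
  by rewrite !inE hp.
split=> x; rewrite -(permKV p x) mem_imset ?cE; try exact: perm_inj.
  exact: h1.
exact: h2.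
Qed.

(** Swapping a deleted vertex of [D] with a kept twin outside [D] preserves domination and size and
    lowers [#|D :\: keep|]. *)
Lemma dominating_in_keep D : dominating sigma rho D ->
  exists2 E, dominating sigma rho E & (E \subset keep) && (#|E| == #|D|).
Proof.
have [k] := ubnP #|D :\: keep|; elim: k D => // k IH D hk hD.
have [hs|/subsetPn[v vD vk]] := boolP (D \subset keep); first by exists D; rewrite ?hs /=.
have [u] := dominating_keep_twin hD vk; rewrite inE => /andP[uD uk] vu.
have [||E hE /andP[Ek /eqP cE]] := IH (tperm v u @: D).
- rewrite ltnS in hk; apply: leq_trans hk.
  rewrite [X in _ < X](cardsD1 v) in_setD vk vD add1n ltnS.
  apply/subset_leq_card/subsetP => x /setDP[/imsetP[y yD e] xk].
  rewrite in_setD1 in_setD xk /=; move: e; case: tpermP => [ey|ey|/eqP yv /eqP yu] e.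
  + by rewrite e uk in xk.
  + by rewrite ey (negPf uD) in yD.
  + by rewrite e yv yD.
- by apply: dominating_aut => // x y; apply: twins_aut.
by exists E => //; rewrite Ek cE card_imset ?eqxx //; apply: perm_inj.
Qed.

Lemma dominating_nonempty D : dominating sigma rho D -> 0 < #|D|.
Proof.
case=> _ h; rewrite card_gt0; apply/eqP => D0.
have := h (Ordinal conG.1); rewrite D0 setI0 cards0 inE => /(_ isT).
by apply/negP.
Qed.

(** The cardinality hypothesis makes [E] miss a kept vertex as soon as some vertex is deleted. *)
Lemma dominating_extend E : E \subset keep -> #|E| + (#|keep| < nverts G) <= #|keep| ->
  (forall x, x \in keep ->
    if x \in E then #|nbr x :&: E| \in sigma else #|nbr x :&: E| \in rho) ->
  dominating sigma rho E.
Proof.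
move=> Ek cE h.
have key v : v \notin E -> #|nbr v :&: E| \in rho.
  move=> vE; have [vk|vk] := boolP (v \in keep); first by have := h v vk; rewrite (negPf vE).
  (* Otherwise a kept common neighbor would see more than [m] vertices of [E], or the graph is a
     single class and [E] is all of [keep]. *)
  have /subsetPn[u] : ~~ (twin_class v :&: keep \subset E).
    apply/negP => hs.
    have [[w wk hw]|hT] := keep_twin_class_nbr conG vk.
      have : #|nbr w :&: E| <= m.
        by have := h w wk; case: ifP => _; [apply: sigma_le|apply: rho_le].
      rewrite leqNgt => /negP; apply; apply: leq_trans (card_twin_class_keep vk) _.
      by apply: subset_leq_card; rewrite subsetI hw.
    have eE : E = keep by apply/eqP; rewrite eqEsubset Ek -[keep]setTI -hT.
    have lt : #|keep| < nverts G.
      have <- : #|[set: vertex G]| = nverts G by rewrite cardsT card_ord.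
      by apply: proper_card; rewrite properT; apply: contraNneq vk => ->; rewrite inE.
    by move: cE; rewrite eE lt addn1 ltnn.
  rewrite !inE => /andP[vu uk] uE.
  have := h u; rewrite (negPf uE); suff -> : nbr v :&: E = nbr u :&: E by apply; rewrite inE.
  (* Members of [E] differ from both [u] and [v], so the twins see the same ones. *)
  apply/setP => x; rewrite !inE; case xE: (x \in E); rewrite ?andbF // !andbT.
  by move/twinsP: vu => -> //; apply: contraTneq xE => ->.
split=> v hv; last exact: key.
by have := h v (subsetP Ek _ hv); rewrite hv.
Qed.

End Domination.

(** A bound of 0 never admits a nonempty set, so raising a negative bound to 0 is harmless; the rest
    is a minimum. *)
Lemma le_clamp (d k b : nat) (K : int) : 0 < d ->
  let cap : int := (Posz k - Posz b)%R in
  (Posz d <= if K <= 0 then 0 else if K <= cap then K else cap)%R =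
  (Posz d <= K)%R && (d + b <= k).
Proof.
move=> d0 cap; rewrite /cap; case: ifP; first lia.
by case: ifP; lia.
Qed.

Lemma yes_induced_keep (sigma rho : {pred nat}) (G : sgraph) (m : nat) (K K' : int) :
  (forall i, i \in sigma -> i <= m) -> (forall i, i \in rho -> i <= m) ->
  0 \notin rho -> connected G ->
  let k := #|keep G m| in
  let cap : int := (Posz k - Posz (k < nverts G))%R in
  K' = (if K <= 0 then 0 else if K <= cap then K else cap)%R ->
  yes_instance sigma rho (Instance G K) <->
  yes_instance sigma rho (Instance (induced (keep G m)) K').
Proof.
move=> sl rl r0 con k cap eK'.
have conI := connected_induced_keep m con.
split=> -[D [hD cD]]; simpl in D, cD.
  have [E hE /andP[Ek /eqP cE]] := dominating_in_keep sl rl con hD.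
  have E0 := dominating_nonempty r0 con hE.
  pose D' : {set vertex (induced (keep G m))} := [set i | enum_val i \in E].
  have eE : [set enum_val i | i in D'] = E.
    apply/setP => x; apply/imsetP/idP => [[i]|xE]; first by rewrite inE => ? ->.
    exists (enum_rank_in (subsetP Ek _ xE) x); rewrite ?inE enum_rankK_in //;
      exact: (subsetP Ek).
  have cD' : #|D'| = #|E| by rewrite -eE card_imset //; apply: enum_val_inj.
  exists D'; split => /=.
    apply/dominating_induced; rewrite eE => x _.
    by case: ifP => [|/negbT]; [apply: hE.1|apply: hE.2].
  rewrite cD'.
  (* If a vertex is deleted, some kept vertex lies outside [E]; this is the slack that the lowered
     bound demands. *)
  have : #|E| + (k < nverts G) <= k.
    case: ltnP => hk /=; last by rewrite addn0; apply: subset_leq_card.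
    have : proper (mem (keep G m)) (mem [set: vertex G]).
      rewrite properEcard subsetT cardsT card_ord; exact: hk.
    case/properP=> _ [v _ vk].
    have [u] := dominating_keep_twin sl rl con hE vk; rewrite inE => /andP[uE uk] _.
    rewrite addn1; apply: proper_card; apply/properP; split=> //.
    by exists u.
  by rewrite eK' le_clamp // -cE in cD *; rewrite cD.
set E := [set enum_val i | i in D].
have cE : #|E| = #|D| by rewrite card_imset //; apply: enum_val_inj.
have Ek : E \subset keep G m.
  by apply/subsetP => x /imsetP[i _ ->]; apply: enum_valP.
have D0 := dominating_nonempty r0 conI hD.
move: cD; rewrite eK' le_clamp // => /andP[cD1 cD2].
have hE : dominating sigma rho E.
  apply: (dominating_extend sl rl con Ek); first by rewrite cE.
  exact: (dominating_induced _ _ _).1.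
by exists E; split=> //=; rewrite cE.
Qed.

(** * The program computes the reduced instance *)

Definition adjacency (G : sgraph) : seq int :=
  [seq Posz (adj u v) | u <- enum (vertex G), v <- enum (vertex G)].

Lemma size_adjacency (G : sgraph) : size (adjacency G) = nverts G * nverts G.
Proof. by rewrite size_allpairs size_enum_ord. Qed.

Lemma nth_flatten_const (T : Type) (x0 : T) n (ss : seq (seq T)) u v :
  all (fun s => size s == n) ss -> v < n ->
  nth x0 (flatten ss) (u * n + v) = nth x0 (nth [::] ss u) v.
Proof.
elim: ss u => [|s ss IH] [|u] //=; rewrite ?nth_nil // => /andP[/eqP ss_n hss] hv.
  by rewrite nth_cat add0n ss_n hv.
by rewrite nth_cat ss_n mulSn -addnA ltnNge leq_addr /= addKn IH.
Qed.

Section Adjacency.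

Variables (G : sgraph) (m : nat).
Local Notation n := (nverts G).
Local Notation A := (adjacency G).

Lemma entry_adjacency (u v : vertex G) : entry n A u v = Posz (adj u v).
Proof.
rewrite /entry /adjacency nth_flatten_const //; last first.
  by apply/allP => s /mapP[w _ ->]; rewrite size_map size_enum_ord.
rewrite (nth_map u) ?size_enum_ord // (nth_map v) ?size_enum_ord //.
by rewrite !nth_ord_enum.
Qed.

Lemma gap_adjacency (u v : vertex G) :
  gap n A u v n = Posz (\sum_(x : vertex G) (adj u x != adj v x)).
Proof.
rewrite /gap big_mkord (big_morph Posz PoszD (erefl (Posz 0))).
apply: eq_bigr => x _; rewrite !entry_adjacency.
by case: (adj u x); case: (adj v x).
Qed.

Lemma twin_adjacency (u v : vertex G) : twin n A u v = twins u v.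
Proof.
rewrite /twin gap_adjacency entry_adjacency.
have [<-|nuv] := eqVneq u v.
  by rewrite twins_refl adj_irr big1 // => x _; rewrite eqxx.
(* Columns [u] and [v] contribute [adj u v] each, which the two subtractions cancel; [s] counts the
   remaining columns where the rows differ. *)
rewrite (bigD1 u) //= (bigD1 v) 1?eq_sym //= !adj_irr (adj_sym v u).
set s := \sum_(_ | _) _.
have -> : (Posz ((adj u v != false) + ((adj u v != false) + s))
   - Posz (adj u v) - Posz (adj u v) <= 0)%R = (s == 0).
  by case: (adj u v) => /=; lia.
rewrite sum_nat_eq0; apply/forall_inP/twinsP => [h x xu xv|h x /andP[xu xv]].
  by have := h x; rewrite xu xv eqb0 negbK => /(_ isT)/eqP.
by rewrite h ?eqxx.
Qed.

Lemma kept_adjacency (v : vertex G) : kept m n A v = (v \in keep G m).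
Proof.
have -> : kept m n A v = (rank n A v <= m.+1) by rewrite /kept /mark; lia.
rewrite inE; congr (_ <= _).
rewrite /rank /ntwins (big_nat_widen _ _ n) ?ltn_ord // big_mkord.
rewrite -sum1_card [RHS]big_mkcond /= [LHS]big_mkcond /=; apply: eq_bigr => u _.
by rewrite !inE twin_adjacency ltnS andbC; case: leqP => _ //; case: twins.
Qed.

Lemma nkept_adjacency : nkept m n A n = #|keep G m|.
Proof.
rewrite /nkept big_mkord -sum1_card [RHS]big_mkcond /=.
by apply: eq_bigr => v _; rewrite kept_adjacency; case: (v \in _).
Qed.

(** Both lists run through the kept vertices in increasing order, so the output follows the
    numbering used by [induced]. *)
Lemma kept_iota (T : Type) (f : nat -> T) :
  [seq f v | v <- iota 0 n & kept m n A v] =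
  [seq f (nat_of_ord v) | v <- enum (keep G m)].
Proof.
rewrite -val_enum_ord filter_map -map_comp {2}/enum_mem -enumT.
by congr map; apply: eq_filter => v; rewrite /= kept_adjacency.
Qed.

Lemma enum_val_enum (T : finType) (S : {set T}) :
  [seq enum_val i | i <- enum 'I_#|S|] = enum S.
Proof.
case: (set_0Vmem S) => [->|[x0 x0S]].
  by rewrite enum_set0; apply: size0nil; rewrite size_map size_enum_ord cards0.
apply: (@eq_from_nth _ x0); first by rewrite size_map size_enum_ord cardE.
move=> i; rewrite size_map size_enum_ord => hi.
by rewrite (nth_map (Ordinal hi)) ?size_enum_ord // (enum_val_nth x0) nth_enum_ord.
Qed.

Lemma rows_adjacency : rows m n A n = adjacency (induced (keep G m)).
Proof.
rewrite /rows /row (kept_iota (fun u => [seq entry n A u v | v <- iota 0 n & kept m n A v])).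
rewrite /adjacency -enum_val_enum -map_comp; congr flatten; apply: eq_map => i /=.
rewrite kept_iota -enum_val_enum -map_comp; apply: eq_map => j /=.
exact: entry_adjacency.
Qed.

Lemma encode_kernel (K : int) :
  [:: Posz (nkept m n A n), bound m n K A & rows m n A n] =
  encode (Instance (induced (keep G m)) (bound m n K A)).
Proof. by rewrite rows_adjacency nkept_adjacency. Qed.

End Adjacency.

(** * Bit lengths of the input and the output, and the kernel *)

Lemma size_input_bits w : size w <= input_bits w.
Proof. by rewrite -sum1_size; apply: leq_sum. Qed.

(** However large [K] is, the new bound is at most the number of kept vertices, so its bits are
    linear in that number too. *)
Lemma bound_range m n K A : 0 < nkept m n A n ->
  (0 <= bound m n K A <= Posz (nkept m n A n))%R.
Proof.
rewrite /bound; move=> k0; have := nkept_le m n A n.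
case: ifP => ?; first lia.
case: ifP => ? ?; first lia.
by case: ltnP; lia.
Qed.

Lemma bitlen_le (k : nat) z : (0 <= z <= Posz k)%R -> bitlen z <= k.+1.
Proof.
move=> h; rewrite /bitlen ltnS; have [-> //|z0] := posnP `|z|%N.
have := trunc_logP (isT : 1 < 2) z0; have := ltn_expl (trunc_log 2 `|z|) (isT : 1 < 2).
lia.
Qed.

Theorem theorem6 (sigma rho : {fset nat}) (h0 : 0%N \notin rho) :
  exists (P : program) (c : nat),
    poly_time_on P
      (fun w => exists I : instance, connected (igraph I) /\ w = encode I) /\
    forall I : instance, connected (igraph I) ->
      exists J : instance,
        [/\ computes P (encode I) (encode J),
            connected (igraph J),
            yes_instance (mem sigma) (mem rho) I
              <-> yes_instance (mem sigma) (mem rho) J &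
            forall b : nat, has_nbr_diversity (igraph I) b ->
              isize J <= c * b /\
              nverts (igraph J)
                <= (maxn (\max_(i <- sigma) i) (\max_(i <- rho) i) + 1) * b].
Proof.
set m := maxn _ _.
(* The kernel has [k <= m.+1 * b] vertices and a bound of at most [k + 1] bits. The extra bit costs
   one more [b], which is positive because the kernel is nonempty. *)
exists (compile 0 (kernel m)), (2 * m.+1 + 1); split.
  exists 100, 3 => w [[G K] [[/= n0 _] ->]].
  have [t ht h] := run_kernel m K n0 (size_adjacency G).
  exists t; eexists; split; first exact: h.
  apply: leq_trans ht _; rewrite leq_mul2l /=.
  (* The input has [n * n + 2] integers of at least one bit, so [n + 1] is at most its number of
     bits, whose cube bounds the time. *)
  have := size_input_bits (encode (Instance G K)).
  rewrite /= -/(adjacency G) size_adjacency; move: (input_bits _) => X hX.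
  rewrite -mulnA !expnS expn0 muln1; have hn : (nverts G).+1 <= X by nia.
  by rewrite !leq_mul.
move=> [G K] /= con.
have [t _ h] := run_kernel m K con.1 (size_adjacency G).
rewrite encode_kernel in h.
exists (Instance (induced (keep G m)) (bound m (nverts G) K (adjacency G))).
split=> /=.
- by exists t.
- exact: connected_induced_keep.
- apply: yes_induced_keep => //; last by rewrite /bound nkept_adjacency.
  + by move=> i hi; rewrite leq_max; apply/orP; left; apply: (leq_bigmax_seq i) hi isT.
  + by move=> i hi; rewrite leq_max; apply/orP; right; apply: (leq_bigmax_seq i) hi isT.
- move=> b hb; have hk := card_keep m hb.
  have k0 := keep_nonempty m con.1.
  have hl := @bound_range m (nverts G) K (adjacency G).
  rewrite nkept_adjacency in hl; have {}hl := bitlen_le (hl k0).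
  have arith k l : k <= m.+1 * b -> 0 < k -> l <= k.+1 ->
      k + l <= (2 * m.+1 + 1) * b /\ k <= (m + 1) * b.
    by case: b {hb hk} => [|b]; nia.
  exact: arith hk k0 hl.
Qed.
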